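(* Let $K$ be an infinite field, let $V$ be a $K$-vector space with $\dim_K(V)=n<\infty$, and let $\mathcal{F}$ be a nonempty finite collection of proper $K$-subspaces of $V$. Let $s=\max\{\dim_K(S) : S\in\mathcal{F}\}$. Let $T\subseteq V$ be a $K$-subspace that is maximal (with respect to inclusion) with the property that $T\cap S=0$ for all $S\in\mathcal{F}$. Then $\dim_K(T)=n-s$.
   Context: A proper subspace of $V$ is a subspace different from $V$ (the zero subspace is allowed when $V\neq 0$). *)

(* Defs.v *)
From mathcomp Require Import all_boot all_order all_algebra.

Set Implicit Arguments.
Unset Strict Implicit.
Unset Printing Implicit Defensive.

Definition avoids (K : fieldType) (V : vectType K) (F : seq {vspace V})
    (T : {vspace V}) : Prop :=
  forall S : {vspace V}, S \in F -> (T :&: S)%VS = 0%VS.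

Definition maximal_avoiding (K : fieldType) (V : vectType K)
    (F : seq {vspace V}) (T : {vspace V}) : Prop :=
  avoids F T /\
  forall T' : {vspace V}, avoids F T' -> (T <= T')%VS -> T' = T.

(* Main.v *)
Require Import Defs.
From mathcomp Require Import all_boot all_order all_algebra.
From mathcomp Require Import classical_sets cardinality.

Import GRing.Theory.
Local Open Scope ring_scope.

(** Every [S] in [F] meets [T] trivially, so [\dim T + \dim S <= n], whence
    [\dim T <= n - s].  If this were strict, each sum [T + S] would have dimension
    at most [\dim T + s < n] and so be proper.  A vector space over an infinite
    field is not a finite union of proper subspaces ([subspace_avoidance]), so
    some [v] lies outside all the sums [T + S].  The space [T + <[v]>] still meets
    every [S] trivially ([capv_add_line_eq0]), and it strictly contains [T]
    because [F] is nonempty: this contradicts the maximality of [T]. *)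

Lemma infinite_notin_seq (T : choiceType) (hT : infinite_set (@setT T))
    (s : seq T) : exists a, a \notin s.
Proof.
apply: boolp.contrapT => none; apply: hT.
apply: (sub_finite_set _ (finite_seq s)) => a _ /=.
by apply/negPn/negP => a_s; apply: none; exists a.
Qed.

(** Two distinct points of the affine line [w + K v] in the same subspace [U]
    would differ by a nonzero multiple of [v], forcing [v] into [U]; so each
    subspace of [G] meets the line at most once. *)
Lemma line_meets_seq (K : fieldType) (V : vectType K) (v w : V)
    (G : seq {vspace V}) :
  {in G, forall U : {vspace V}, v \notin U} ->
  exists s : seq K, forall a, a \notin s -> {in G, forall U : {vspace V}, w + a *: v \notin U}.
Proof.
elim: G => [|U G IHG] vG; first by exists [::].
have [|s sG] := IHG; first by move=> W WG; apply: vG; rewrite inE WG orbT.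
have vU : v \notin U by apply: vG; rewrite mem_head.
have [b bU] : exists b, forall a, a != b -> w + a *: v \notin U.
  have [[b wbU]|none] := boolp.pselect (exists b, w + b *: v \in U).
    exists b => a neq_ab; apply: contra vU => waU.
    have := rpredB waU wbU.
    by rewrite opprD addrACA subrr add0r -scalerBl rpredZeq subr_eq0 (negPf neq_ab).
  (* The line misses [U], so no parameter needs excluding: [0] is a dummy. *)
  by exists 0 => a _; apply/negP => waU; apply: none; exists a.
exists (b :: s) => a; rewrite inE negb_or => /andP[neq_ab a_s] W.
by rewrite inE => /predU1P[->|WG]; [apply: bU | apply: sG a_s W WG].
Qed.

(** If [v] avoids all of [G] but lies in a further proper subspace [U], move it:
    for [w] outside [U] the whole line [w + K v] is outside [U], and all but
    finitely many of its points avoid [G]. *)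
Lemma subspace_avoidance (K : fieldType) (hK : infinite_set (@setT K))
    (V : vectType K) (G : seq {vspace V}) :
  {in G, forall U : {vspace V}, U != fullv} -> exists v, {in G, forall U : {vspace V}, v \notin U}.
Proof.
elim: G => [|U G IHG] properG; first by exists 0.
have [|v vG] := IHG; first by move=> W WG; apply: properG; rewrite inE WG orbT.
have [vU|vU] := boolP (v \in U); last first.
  by exists v => W; rewrite inE => /predU1P[->|/vG].
have : ~~ (fullv <= U)%VS.
  by apply: contra (properG U (mem_head _ _)); rewrite eqEsubv subvf.
case/subvPn=> w _ wU; have [s sG] := line_meets_seq _ _ _ w _ vG.
have [a a_s] := infinite_notin_seq _ hK s.
exists (w + a *: v) => W; rewrite inE => /predU1P[->|WG]; last exact: sG WG.
by rewrite rpredDr // rpredZ.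
Qed.

(** If [t + a v] lies in [S] then [a v] lies in [T + S], so [a = 0] and
    [t] lies in [T :&: S]. *)
Lemma capv_add_line_eq0 (K : fieldType) (V : vectType K) (T S : {vspace V})
    (v : V) :
  (T :&: S = 0)%VS -> v \notin (T + S)%VS -> ((T + <[v]>) :&: S = 0)%VS.
Proof.
move=> TS0 vTS; apply/eqP; rewrite -subv0; apply/subvP => x.
rewrite memv_cap => /andP[/memv_addP[t tT [_ /vlineP[a ->] ->]]] xS.
have : a *: v \in (T + S)%VS.
  rewrite -[a *: v](addKr t); apply: memv_add xS.
  by rewrite rpredN.
rewrite rpredZeq (negPf vTS) orbF => /eqP a0.
by rewrite -TS0 memv_cap; move: xS; rewrite a0 scale0r addr0 tT.
Qed.

Local Close Scope ring_scope.

Theorem theorem2 (K : fieldType) (hK : infinite_set (@setT K))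
    (V : vectType K) (n : nat) (hn : \dim (fullv : {vspace V}) = n)
    (F : seq {vspace V}) (hF : F <> [::])
    (hproper : forall S : {vspace V}, S \in F -> S <> fullv)
    (s : nat) (hs : s = (\max_(S <- F) \dim S)%N)
    (T : {vspace V}) (hT : maximal_avoiding F T) :
  \dim T = (n - s)%N.
Proof.
case: hT => avT maxT.
have dimS_le S : S \in F -> \dim S <= s.
  by move=> SF; rewrite hs; apply: leq_bigmax_seq.
have dimTn : \dim T <= n by rewrite -hn dimvS ?subvf.
have dim_add S : S \in F -> \dim (T + S) = \dim T + \dim S.
  by move=> /avT TS0; rewrite dimv_disjoint_sum.
have s_le : s <= n - \dim T.
  rewrite hs; apply/bigmax_leqP_seq => S SF _.
  by rewrite leq_subRL // -dim_add // -hn dimvS ?subvf.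
have s_n : s <= n by apply: leq_trans s_le (leq_subr _ _).
apply/eqP; rewrite eqn_leq; apply/andP; split.
  by rewrite leq_subRL // addnC -leq_subRL.
rewrite leqNgt; apply/negP => ltT.
have [U|v vF] := subspace_avoidance K hK V [seq (T + W)%VS | W <- F].
  case/mapP=> S SF ->; apply/eqP => TSfull.
  have := dim_add S SF; rewrite TSfull hn => dimTS.
  have : \dim T + s < n by rewrite addnC -ltn_subRL.
  by rewrite ltnNge dimTS leq_add2l dimS_le.
have vTS S : S \in F -> v \notin (T + S)%VS.
  by move=> SF; apply: vF; apply: map_f.
have TvT : (T + <[v]>)%VS = T.
  apply: maxT (addvSl _ _) => S SF.
  by apply: capv_add_line_eq0 (vTS S SF); apply: avT.
case: F hF vTS {hproper hs avT maxT dimS_le dim_add s_le vF} => [//|S0 F] _ vTS.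
have /negP[] := vTS S0 (mem_head _ _).
apply: (subvP (addvSl T S0)); rewrite -TvT.
exact: (subvP (addvSr _ _)) (memv_line v).
Qed.
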